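(* Let $\mathcal{N}$, $\tilde{\mathcal{N}}$ be admissible algebras with admissible projections $\pi$, $\tilde\pi$, respectively. Then $\mathcal{N}$ and $\tilde{\mathcal{N}}$ are isomorphic if and only if the hypersurfaces $S_\pi\subset\mathcal{N}$ and $S_{\tilde\pi}\subset\tilde{\mathcal{N}}$ are affinely equivalent.
   Context: All algebras are over $\mathbb{C}$. A finite-dimensional commutative associative algebra $\mathcal{N}$ is nilpotent if $\mathcal{N}^{\nu+1}=0$ for some $\nu\ge 0$, where $\mathcal{N}^1:=\mathcal{N}$ and $\mathcal{N}^{j+1}$ is the linear span of $\mathcal{N}\,\mathcal{N}^j$. It is admissible if it is nilpotent and its annihilator $\mathrm{Ann}(\mathcal{N}):=\{u\in\mathcal{N}:u\,\mathcal{N}=0\}$ has dimension 1. An admissible projection on $\mathcal{N}$ is a linear projection $\pi:\mathcal{N}\to\mathrm{Ann}(\mathcal{N})$ with range $\mathrm{Ann}(\mathcal{N})$. Let $\mathcal{N}^0:=\mathbb{C}\oplus\mathcal{N}$ be the unital extension of $\mathcal{N}$, and extend $\pi$ to $\mathcal{N}^0$ linearly by $\pi(1)=0$. Let $Q'_\pi:=\{w\in 1+\mathcal{N}:\pi(w^2)=0\}$, an affine quadric in $1+\mathcal{N}$, and let $\log:1+\mathcal{N}\to\mathcal{N}$, $\log(1+u):=\sum_{m\ge1}\frac{(-1)^{m+1}}{m}u^m$, which is the inverse of the map $\exp:\mathcal{N}\to1+\mathcal{N}$, $\exp(u)=1+\sum_{m\ge1}\frac{u^m}{m!}$ (all sums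 are finite). Define $S_\pi:=\log(Q'_\pi)\subset\mathcal{N}$. Equivalently, $S_\pi=\{u\in\mathcal{N}:\pi(\exp_1(2u))=0\}$, where $\exp_1(u):=\sum_{m\ge1}\frac{u^m}{m!}$. Two hypersurfaces in complex vector spaces are affinely equivalent if there is a complex affine isomorphism between the ambient spaces mapping one onto the other. Isomorphic means isomorphic as associative complex algebras. *)

(* Defs.v *)
From HB Require Import structures.
From mathcomp Require Import all_boot all_order all_algebra.
From mathcomp Require Import classical_sets fsbigop reals.
From mathcomp.real_closed Require Export complex.

Set Implicit Arguments.
Unset Strict Implicit.
Unset Printing Implicit Defensive.

Import GRing.Theory.
Local Open Scope ring_scope.

(* Finite-dimensional commutative associative algebras, not assumed unital:
   the library's falgType and comAlgType always carry a unit. *)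
HB.mixin Record Vector_isNonunitalComAlg (K : fieldType) A of Vector K A := {
  nmul : A -> A -> A;
  nmulA : associative nmul;
  nmulC : commutative nmul;
  nmulDl : left_distributive nmul +%R;
  nscalerAl : forall (a : K) (u v : A), a *: nmul u v = nmul (a *: u) v
}.

#[short(type="nuComAlgType")]
HB.structure Definition NonunitalComAlg (K : fieldType) :=
  {A of Vector K A & Vector_isNonunitalComAlg K A}.

Section AlgebraTheory.
Variables (K : fieldType) (A : nuComAlgType K).
Implicit Types (u v : A) (U V W : {vspace A}).

Lemma nmulDr : right_distributive (@nmul K A) +%R.
Proof. by move=> u v w; rewrite nmulC nmulDl !(nmulC _ u). Qed.

Lemma nscalerAr (a : K) u v : a *: nmul u v = nmul u (a *: v).
Proof. by rewrite nmulC nscalerAl nmulC. Qed.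

Fact nmul_is_linear u : linear (nmul u : A -> A).
Proof. by move=> a v w; rewrite nmulDr nscalerAr. Qed.
HB.instance Definition _ u :=
  GRing.isLinear.Build K A A *:%R (nmul u) (nmul_is_linear u).

Definition lmul u : 'End(A) := linfun (nmul u).

Fact lmul_is_linear : linear lmul.
Proof.
move=> a u v; apply/lfunP => w.
by rewrite add_lfunE scale_lfunE !lfunE /= nmulDl nscalerAl.
Qed.
HB.instance Definition _ :=
  GRing.isLinear.Build K A 'End(A) *:%R lmul lmul_is_linear.

Lemma nmul0 u : nmul u 0 = 0. Proof. exact: linear0. Qed.
Lemma nmul0l u : nmul 0 u = 0. Proof. by rewrite nmulC nmul0. Qed.

Definition Ann : {vspace A} := lker (linfun lmul).

Lemma AnnP u : reflect (forall v, nmul u v = 0) (u \in Ann).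
Proof.
rewrite memv_ker lfunE; apply: (iffP eqP) => [u0 v | u0].
  by have /lfunP/(_ v) := u0; rewrite !lfunE.
by apply/lfunP => v; rewrite !lfunE /= u0.
Qed.

(* As for prodv in falgebra, bases suffice to generate the linear span of all
   products; nprodvP is its universal property. *)
Definition nprodv U V : {vspace A} :=
  <<allpairs (@nmul K A) (vbasis U) (vbasis V)>>%VS.

Lemma memv_nmul U V u v : u \in U -> v \in V -> nmul u v \in nprodv U V.
Proof.
move=> /coord_vbasis-> /coord_vbasis->.
rewrite linear_sum; apply: memv_suml => j _ /=.
rewrite nmulC linear_sum; apply: memv_suml => i _ /=.
rewrite -nscalerAl -nscalerAr !memvZ // nmulC memv_span //.
by apply/allpairsP; exists ((vbasis U)`_i, (vbasis V)`_j); rewrite !memt_nth.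
Qed.

Lemma nprodvP U V W :
  reflect (forall u v, u \in U -> v \in V -> nmul u v \in W)
          (nprodv U V <= W)%VS.
Proof.
apply: (iffP idP) => [sUVW u v Uu Vv | sUVW].
  exact: subvP sUVW _ (memv_nmul Uu Vv).
apply/span_subvP => _ /allpairsP[[u v] /= [Uu Vv ->]].
by rewrite sUVW ?vbasis_mem.
Qed.

End AlgebraTheory.

Arguments Ann {K} A.

(* npow A j is the j-th power of A, meaningful for j >= 1 only (npow A 0 is
   the junk value fullv and is not the unital extension). *)
Definition npow (K : fieldType) (A : nuComAlgType K) (j : nat) : {vspace A} :=
  iter j.-1 (nprodv fullv) fullv.

Definition nilpotent_alg (K : fieldType) (A : nuComAlgType K) : Prop :=
  exists nu : nat, npow A nu.+1 = 0%VS.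

Definition admissible (K : fieldType) (A : nuComAlgType K) : Prop :=
  nilpotent_alg A /\ \dim (Ann A) = 1.

Definition admissible_projection (K : fieldType) (A : nuComAlgType K)
    (pi : 'End(A)) : Prop :=
  (pi \o pi = pi)%VF /\ limg pi = Ann A.

Definition alg_isomorphic (K : fieldType) (A B : nuComAlgType K) : Prop :=
  exists f : 'Hom(A, B),
    bijective f /\ forall u v : A, f (nmul u v) = nmul (f u) (f v).

Definition unital_ext (K : fieldType) (A : nuComAlgType K) : Type :=
  (K^o * A)%type.

Section UnitalExtension.
Variables (K : fieldType) (A : nuComAlgType K).
Local Notation A0 := (unital_ext A).

HB.instance Definition _ := Vector.copy A0 (K^o * A)%type.

Definition ue_one : A0 := (1, 0).
Definition ue_mul (x y : A0) : A0 :=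
  (x.1 * y.1, (x.1 : K) *: y.2 + (y.1 : K) *: x.2 + nmul x.2 y.2).

Fact ue_mulC : commutative ue_mul.
Proof.
move=> x y; rewrite /ue_mul nmulC (addrC (x.1 *: _)).
by congr pair; apply: mulrC.
Qed.

Fact ue_mulDl : left_distributive ue_mul +%R.
Proof.
move=> x y z; congr pair; first exact: mulrDl.
rewrite /= scalerDl scalerDr nmulDl [RHS]addrACA; congr (_ + _).
exact: addrACA.
Qed.

Fact ue_mulA : associative ue_mul.
Proof.
move=> x y z; congr pair; first exact: mulrA.
rewrite /= !(nmulDr, nmulDl, scalerDr) -!nscalerAl -!nscalerAr !scalerA nmulA.
rewrite (mulrC z.1 x.1) (mulrC z.1 y.1) -!addrA; congr (_ + (_ + _)).
rewrite addrCA; congr (_ + _); rewrite [RHS]addrCA; congr (_ + _).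
exact: addrCA.
Qed.

Fact ue_mul1 : left_id ue_one ue_mul.
Proof.
move=> [a u]; rewrite /ue_mul /= nmul0l scaler0 !addr0 scale1r.
by congr pair; apply: mul1r.
Qed.

Fact ue_one_neq0 : ue_one != 0.
Proof. by apply/eqP => -[/eqP]; rewrite oner_eq0. Qed.

HB.instance Definition _ := GRing.Zmodule_isComNzRing.Build A0
  ue_mulA ue_mulC ue_mul1 ue_mulDl ue_one_neq0.

Fact ue_scalerAl (a : K) (x y : A0) : a *: (x * y) = (a *: x) * y.
Proof.
congr pair; first exact: mulrA.
rewrite /= !scalerDr nscalerAl !scalerA; congr (_ + _ + _).
by rewrite mulrC.
Qed.

HB.instance Definition _ := GRing.Lmodule_isLalgebra.Build K A0 ue_scalerAl.
HB.instance Definition _ := GRing.Lalgebra_isComAlgebra.Build K A0.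

Definition ue_inj (u : A) : A0 := (0, u).

Definition ue_proj (pi : 'End(A)) (w : A0) : A := pi w.2.

Lemma ue_proj1 pi : ue_proj pi 1 = 0.
Proof. exact: linear0. Qed.

Lemma ue_proj_inj pi u : ue_proj pi (ue_inj u) = pi u.
Proof. by []. Qed.

Local Open Scope classical_set_scope.

Definition one_plus : set A0 := [set 1 + ue_inj u | u in setT].

(* The sum is finitely supported on one_plus A when A is nilpotent; its terms
   lie in the ideal A, hence the second projection. *)
Definition nlog (w : A0) : A :=
  \sum_(m \in [set m : nat | (0 < m)%N])
     ((-1) ^+ m.+1 / m%:R) *: ((w - 1) ^+ m).2.

Definition Qquadric (pi : 'End(A)) : set A0 :=
  [set w | one_plus w /\ ue_proj pi (w ^+ 2) = 0].

Definition Spi (pi : 'End(A)) : set A := nlog @` Qquadric pi.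

End UnitalExtension.

Local Open Scope classical_set_scope.

Definition affinely_equivalent (K : fieldType) (V W : vectType K)
    (S : set V) (T : set W) : Prop :=
  exists (f : 'Hom(V, W)) (b : W),
    bijective f /\ [set f x + b | x in S] = T.

(* Main.v *)
Require Import Defs.
From HB Require Import structures.
From mathcomp Require Import all_boot all_order all_algebra.
From mathcomp Require Import classical_sets fsbigop reals.
From mathcomp Require Import ring.

Set Implicit Arguments.
Unset Strict Implicit.
Unset Printing Implicit Defensive.

Import Order.TTheory GRing.Theory Num.Theory.
Local Open Scope ring_scope.

(** Write A0 for the unital extension of an admissible algebra A, and compose
    the projection with a coordinate on the annihilator to obtain a linear
    functional L on A0 that vanishes at 1 and not on the annihilator.  Since
    exp is a bijection from A onto 1 + A that turns sums into products,
    the hypersurface is the set of all u such that L (exp (2 u)) = 0.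

    The pairing (x, y) |-> L (x y) on A0 is nondegenerate
    ([dualizing_nondeg]): A0 is a Gorenstein local ring.  Hence every functional
    on A0 has the form x |-> L (q x) for some q ([dualizing_represent]).  If f
    is an isomorphism from A to B and M is a functional of the same kind for B,
    this applies to the pullback of M along f; the element q found there is
    a scalar multiple of exp (2 p) for some p, so M (exp (2 (f u))) is
    proportional to L (exp (2 (u + p))).  Thus the affine map u |-> f u - f p
    carries one hypersurface onto the other ([alg_iso_tube]).

    Conversely, let the affine map u |-> f u + b carry the hypersurface of L
    onto that of M.  The image b of 0 lies on the latter, so replacing M by
    y |-> M (exp (2 b) y), which is again a functional of the same kind, makes
    b disappear: L (exp u) = 0 implies M (exp (f u)) = 0.  In the direction of
    the annihilator L (exp u) is affine with slope 1, so that the hypersurface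
    is the graph of a polynomial; the same holds for M.  Restricted to lines,
    these two graph descriptions of one set give mutually inverse polynomial
    maps of the line, which must have degree one, and it follows that
    M (exp (f u)) = c L (exp u) for a constant c ([graph_proportional]).
    Comparing the homogeneous parts of degree 1, 2 and 3 in u and polarizing,
    M (f u), M (f u f v) and M (f u f v f w) are c times L u, L (u v) and
    L (u v w).  Therefore f (u v) - f u f v is orthogonal to all of B0, and it
    vanishes by nondegeneracy: the linear part f of the affine equivalence is
    itself an isomorphism of algebras ([linear_equivalence_morph]). *)

(** * Truncated exponential and logarithm series *)

Section TruncatedSeries.
Variable K : numFieldType.

Definition exp_poly n : {poly K} := \poly_(m < n) (m`!%:R)^-1.
(** The term of index 0 vanishes, because the inverse of 0 is 0. *)
Definition log_poly n : {poly K} := \poly_(m < n) ((-1) ^+ m.+1 / m%:R).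

Lemma fact_neq0 n : n`!%:R != 0 :> K.
Proof. by rewrite pnatr_eq0 -lt0n fact_gt0. Qed.

Lemma deriv_exp_poly n : (exp_poly n.+1)^`() = exp_poly n.
Proof.
apply/polyP=> k; rewrite coef_deriv !coef_poly ltnS.
case: ifP => _; last by rewrite mul0rn.
rewrite -[_ *+ k.+1]mulr_natl factS natrM invfM mulrA divff ?mul1r //.
by rewrite pnatr_eq0.
Qed.

Lemma deriv_log_poly n : (1 + 'X) * (log_poly n.+1)^`() = 1 - (- 'X) ^+ n.
Proof.
have -> : (log_poly n.+1)^`() = \sum_(i < n) (- 'X) ^+ i.
  apply/polyP=> k; rewrite coef_deriv coef_poly ltnS coef_sum.
  under eq_bigr => i _ do
    rewrite exprNn -(rmorphN1 polyC) -rmorphXn coefCM coefXn.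
  case: ltnP => [kn|nk].
    rewrite (bigD1 (Ordinal kn)) //= big1 => [|i /eqP/eqP]; last first.
      rewrite -(inj_eq val_inj) /= => /negPf; rewrite eq_sym => ->.
      by rewrite mulr0.
    rewrite eqxx mulr1 addr0 -[LHS]mulr_natr -mulrA mulVf ?pnatr_eq0 //.
    by rewrite mulr1 2!exprS mulrA mulrNN mul1r mul1r.
  rewrite mul0rn big1 // => i _; rewrite gtn_eqF ?mulr0 //.
  exact: leq_trans nk.
by rewrite -opprB subrX1 -mulNr opprB opprK.
Qed.

(** Both sides solve the differential equation (1 + X) Y' = Y up to order n,
    with Y(0) = 1, and that equation determines the coefficients of Y one after
    the other. *)
Lemma exp_log_poly n :
  exists q : {poly K}, exp_poly n.+1 \Po log_poly n.+1 = 1 + 'X + q * 'X^(n.+1).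
Proof.
set e := exp_poly n.+1; set l := log_poly n.+1; set P := e \Po l.
have [l1 l1E] : exists l1 : {poly K}, l = l1 * 'X.
  exists (drop_poly 1 l); rewrite -[LHS](poly_take_drop 1) expr1.
  rewrite [take_poly _ _](_ : _ = 0) ?add0r //; apply/polyP => -[|k].
    by rewrite coef_take_poly coef_poly invr0 mulr0 coef0.
  by rewrite coef_take_poly coef0.
have [r rE] : exists r : {poly K}, (1 + 'X) * P^`() = P + r * 'X^n.
  exists (- ((-1) ^+ n * (e^`() \Po l) + (n`!%:R)^-1 *: l1 ^+ n)).
  have PE : P = (exp_poly n \Po l) + (n`!%:R)^-1 *: l ^+ n.
    rewrite /P /e /exp_poly !poly_def big_ord_recr /= !rmorphD /=.
    by rewrite linearZ /= rmorphXn /= comp_polyX.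
  rewrite [X in _ = X + _]PE /P deriv_comp mulrCA deriv_log_poly.
  by rewrite /e deriv_exp_poly l1E exprMn -!mul_polyC (exprNn 'X); ring.
have Pdiff k : (k < n)%N -> P`_k.+1 *+ k.+1 + P`_k *+ k = P`_k.
  move=> kn; have := congr1 (fun p : {poly K} => p`_k) rE.
  rewrite mulrDl mul1r !coefD coefXM coefMXn kn addr0 !coef_deriv.
  by case: k {kn} => [|k] //=; rewrite mulr0n.
have P0 : P`_0 = 1.
  rewrite -horner_coef0 horner_comp l1E hornerMX mulr0 horner_coef0.
  by rewrite coef_poly /= invr1.
have Pk k : (k < n.+1)%N -> P`_k = (1 + 'X)`_k.
  elim: k => [|k IHk] kn; first by rewrite P0 coefD coef1 coefX addr0.
  have := Pdiff _ kn; rewrite IHk; last exact: ltnW.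
  rewrite !coefD !coef1 !coefX /= add0r.
  case: k {IHk kn} => [|[|k]] /=.
  - by rewrite mulr0n !addr0.
  - by rewrite add0r -[RHS]add0r => /addIr/eqP; rewrite mulrn_eq0 /= => /eqP.
  - by rewrite addr0 mul0rn addr0 => /eqP; rewrite mulrn_eq0 /= => /eqP.
exists (drop_poly n.+1 (P - (1 + 'X))).
apply/eqP; rewrite addrC -subr_eq; apply/eqP.
rewrite -[LHS](poly_take_drop n.+1) [take_poly _ _](_ : _ = 0) ?add0r //.
apply/polyP => k; rewrite coef_take_poly coef0; case: ifP => // kn.
by rewrite coefB Pk // subrr.
Qed.

Variable A : comAlgType K.
Implicit Types x y : A.

Definition texp n x : A := \sum_(m < n) (m`!%:R)^-1 *: x ^+ m.

Lemma texp0 n : texp n.+1 0 = 1.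
Proof.
rewrite /texp big_ord_recl big1 ?addr0 => [|i _]; last first.
  by rewrite expr0n scaler0.
by rewrite /= expr0 invr1 scale1r.
Qed.

Lemma texp_sq0 n x : x ^+ 2 = 0 -> x ^+ n.+1 = 0 -> texp n.+1 x = 1 + x.
Proof.
rewrite /texp => x2; case: n => [|n] xn.
  rewrite expr1 in xn.
  by rewrite xn big_ord_recl big_ord0 invr1 scale1r expr0.
rewrite 2!big_ord_recl big1 => [|i _]; rewrite /= ?invr1 ?scale1r ?addr0 //.
by rewrite !exprS mulrA -expr2 x2 mul0r scaler0.
Qed.

(** The Cauchy product is exact as soon as the truncation drops vanishing terms
    only; carrying the degree in a formal variable keeps track of it. *)
Lemma texpD n x y : x ^+ n = 0 -> y ^+ n = 0 -> (x + y) ^+ n = 0 ->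
  texp n (x + y) = texp n x * texp n y.
Proof.
pose E z : {poly A} := \poly_(m < n) ((m`!%:R)^-1 *: z ^+ m).
have coefE z k : z ^+ n = 0 -> (E z)`_k = (k`!%:R)^-1 *: z ^+ k.
  move=> zn; rewrite coef_poly; case: ltnP => // nk.
  by rewrite -(subnK nk) exprD zn mulr0 scaler0.
have EvalE z : texp n z = (E z).[1].
  rewrite /texp (horner_coef_wide _ (size_poly _ _)).
  by apply: eq_bigr => i _; rewrite expr1n mulr1 coef_poly ltn_ord.
move=> xn yn xyn; rewrite !EvalE -hornerM; congr horner.
apply/polyP => k; rewrite coefMr coefE // exprDn scaler_sumr.
apply: eq_bigr => i _; have ik : (i <= k)%N by rewrite -ltnS.
rewrite !coefE // -scalerAl -scalerAr scalerA -scaler_nat scalerA.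
congr (_ *: _); rewrite -(bin_fact ik) !natrM.
have := fact_neq0 i; have := fact_neq0 (k - i).
have : 'C(k, i)%:R != 0 :> K by rewrite pnatr_eq0 -lt0n bin_gt0.
by move=> b0 f0 g0; field; rewrite b0 f0 g0.
Qed.

(** Factoring exp x - 1 = x (1 - x r) with x nilpotent, the second factor is
    invertible. *)
Lemma texp_inj0 n x : x ^+ n = 0 -> texp n x = 1 -> x = 0.
Proof.
case: n => [|n] xn; first by rewrite -[x]mulr1 -(expr0 x) xn mulr0.
case: n xn => [|n] xn; first by move: xn; rewrite expr1.
have [r ->] : exists r, texp n.+2 x = 1 + x * (1 - x * r).
  exists (- \sum_(i < n) (i.+2`!%:R)^-1 *: x ^+ i).
  rewrite /texp 2!big_ord_recl /= invr1 !scale1r expr0 expr1.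
  congr (_ + _); rewrite mulrBr mulr1; congr (_ + _).
  rewrite !mulrN opprK mulrA !mulr_sumr; apply: eq_bigr => i _.
  by rewrite -scalerAr /= !exprS mulrA.
rewrite -[RHS]addr0 => /addrI; rewrite mulrBr mulr1 => /eqP.
rewrite subr_eq0 => /eqP xE.
(* Iterating x = x (x r) brings in arbitrarily high powers of x. *)
have step k : x = x ^+ k.+1 * r ^+ k.
  elim: k => [|k IHk]; first by rewrite expr1 expr0 mulr1.
  rewrite {1}IHk exprS {1}xE !exprS; ring.
by rewrite (step n.+1) xn mul0r.
Qed.

Lemma texp_inj n x y :
    x ^+ n.+1 = 0 -> y ^+ n.+1 = 0 -> (x - y) ^+ n.+1 = 0 ->
  texp n.+1 x = texp n.+1 y -> x = y.
Proof.
move=> xn yn xyn exy.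
have Nyn : (- y) ^+ n.+1 = 0 by rewrite exprNn yn mulr0.
apply/eqP; rewrite -subr_eq0; apply/eqP/(texp_inj0 xyn).
rewrite texpD // exy -texpD ?subrr ?texp0 //.
by rewrite expr0n.
Qed.

Lemma texp_log n x : x ^+ n.+1 = 0 ->
  texp n.+1 (\sum_(m < n.+1) ((-1) ^+ m.+1 / m%:R) *: x ^+ m) = 1 + x.
Proof.
move=> xn; have [q qE] := exp_log_poly n.
have -> : \sum_(m < n.+1) ((-1) ^+ m.+1 / m%:R) *: x ^+ m =
          horner_alg x (log_poly n.+1).
  rewrite /log_poly poly_def linear_sum; apply: eq_bigr => i _.
  by rewrite linearZ /= rmorphXn /= horner_algX mulr_algl.
transitivity (horner_alg x (exp_poly n.+1 \Po log_poly n.+1)); last first.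
  rewrite qE !rmorphD /= rmorph1 rmorphM /= rmorphXn /= horner_algX xn mulr0.
  by rewrite addr0.
rewrite /texp /exp_poly poly_def !linear_sum; apply: eq_bigr => i _ /=.
by rewrite !linearZ /= !rmorphXn /= comp_polyX mulr_algl.
Qed.

End TruncatedSeries.

(** * Dualizing functionals on the unital extension *)

Section UnitalExtension.
Variables (K : fieldType) (A : nuComAlgType K).
Local Notation A0 := (unital_ext A).
Local Notation inj := (@ue_inj K A).

Fact ue_inj_is_linear : linear inj.
Proof. by move=> a u v; congr pair; rewrite /= scaler0 addr0. Qed.
HB.instance Definition _ :=
  GRing.isLinear.Build K A A0 *:%R inj ue_inj_is_linear.

Lemma ue_injM u v : inj (nmul u v) = inj u * inj v.
Proof. by congr pair; rewrite /= ?mul0r // !scale0r !add0r. Qed.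

Lemma ue_decomp (w : A0) : w = (w.1 : K) *: (1 : A0) + inj w.2.
Proof.
case: w => a u; congr pair; first by rewrite /= addr0 [RHS]mulr1.
by rewrite /= scaler0 add0r.
Qed.

Lemma ue_injMl (w : A0) u : w * inj u = inj ((w.1 : K) *: u + nmul w.2 u).
Proof.
by rewrite {1}[w]ue_decomp mulrDl mulr_algl -linearZ -ue_injM -linearD.
Qed.

Lemma ue_inj_expr k u : (inj u ^+ k.+1).1 = 0.
Proof. by rewrite exprS; apply: mul0r. Qed.

Lemma npowSS j : npow A j.+2 = nprodv fullv (npow A j.+1).
Proof. by []. Qed.

Lemma npow_expr u j : exists2 x, x \in npow A j.+1 & inj u ^+ j.+1 = inj x.
Proof.
elim: j => [|j [x xj xE]]; first by exists u; rewrite ?memvf ?expr1.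
exists (nmul u x); last by rewrite exprS xE ue_injM.
by rewrite npowSS memv_nmul ?memvf.
Qed.

Lemma nil_ue_inj n u : npow A n.+1 = 0%VS -> inj u ^+ n.+1 = 0.
Proof.
move=> An; have [x] := npow_expr u n.
by rewrite An memv0 => /eqP -> ->; rewrite linear0.
Qed.

Lemma npow_eq0_leq n m : (n <= m)%N -> npow A n.+1 = 0%VS -> npow A m.+1 = 0%VS.
Proof.
move=> nm An; rewrite -(subnK nm); elim: (m - n)%N => [|k IHk] //.
rewrite addSn npowSS IHk; apply/eqP; rewrite -subv0.
by apply/nprodvP => u v _; rewrite memv0 => /eqP ->; rewrite nmul0 mem0v.
Qed.

(** For an admissible algebra the annihilator is the socle of the unital
    extension, and being nonzero on it makes the form (x, y) |-> L (x y)
    nondegenerate; the condition L 1 = 0 puts the origin on the hypersurface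
    L (exp (2 u)) = 0. *)
Definition dualizing (L : {scalar A0}) : Prop :=
  L 1 = 0 /\ forall x, x \in Ann A -> L (inj x) = 0 -> x = 0.

Lemma dualizing_Ann (L : {scalar A0}) : \dim (Ann A) = 1 -> dualizing L ->
  exists2 a, a \in Ann A & L (inj a) = 1.
Proof.
move=> dimA [_ L0]; have A0' : Ann A != 0%VS by rewrite -dimv_eq0 dimA.
have La : L (inj (vpick (Ann A))) != 0.
  by apply: contraNneq A0' => /(L0 _ (memv_pick _)) /eqP; rewrite vpick0.
exists ((L (inj (vpick (Ann A))))^-1 *: vpick (Ann A)).
  by rewrite memvZ ?memv_pick.
by rewrite !linearZ /= mulVf.
Qed.

Lemma Ann_mul a (w : A0) : a \in Ann A -> w * inj a = (w.1 : K) *: inj a.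
Proof.
by move=> /AnnP aN; rewrite ue_injMl nmulC aN addr0 linearZ.
Qed.

(** A vector orthogonal to everything generates an ideal on which L vanishes;
    by nilpotency a nonzero ideal contains nonzero elements of the annihilator,
    found by descending along the powers of the algebra. *)
Lemma dualizing_nondeg_nil (L : {scalar A0}) v : nilpotent_alg A ->
    dualizing L -> L (inj v) = 0 -> (forall u, L (inj v * inj u) = 0) -> v = 0.
Proof.
move=> [n An] [_ L0].
have desc k : forall z, z \in npow A (n - k).+1 -> L (inj z) = 0 ->
    (forall u, L (inj z * inj u) = 0) -> z = 0.
  elim: k => [|k IHk] z zj Lz Lzu.
    by move: zj; rewrite subn0 An memv0 => /eqP.
  have [nk|kn] := leqP n k.
    apply: IHk => //; move: zj; rewrite -subn_eq0 in nk.
    by rewrite subnS (eqP nk).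
  apply: L0 => //; apply/AnnP => u; apply: IHk; last 2 first.
  - by rewrite ue_injM Lzu.
  - by move=> u'; rewrite ue_injM -mulrA -ue_injM Lzu.
  by rewrite -(subnSK kn) npowSS nmulC memv_nmul ?memvf.
by move=> Lv Lvu; apply: (desc n) => //; rewrite subnn memvf.
Qed.

Lemma dualizing_nondeg (L : {scalar A0}) (x : A0) : admissible A ->
  dualizing L -> (forall y, L (x * y) = 0) -> x = 0.
Proof.
move=> [nilA dimA] dL Lx; have [a aN La] := dualizing_Ann dimA dL.
have x1 : x.1 = 0.
  by have := Lx (inj a); rewrite Ann_mul // linearZ /= La mulr1.
have xE : x = inj x.2 by rewrite {1}[x]ue_decomp x1 scale0r add0r.
move: Lx; rewrite xE; move: x.2 => v Lv.
rewrite (dualizing_nondeg_nil nilA dL (v := v)) ?linear0 //.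
by rewrite -[inj _]mulr1.
Qed.

(** The map q |-> L (q _) from A0 to its dual is injective by nondegeneracy,
    hence surjective by equality of dimensions. *)
Lemma dualizing_represent (L M : {scalar A0}) : admissible A -> dualizing L ->
  exists q, forall x, M x = L (q * x).
Proof.
move=> admA dL.
pose th (q : A0) : 'Hom(A0, K^o) := linfun (L \o (q \*o idfun) : A0 -> K^o).
have thE q x : th q x = L (q * x) by rewrite lfunE.
have th_lin : linear th.
  move=> a p q; apply/lfunP => x; rewrite add_lfunE scale_lfunE !thE.
  by rewrite mulrDl linearD -scalerAl linearZ.
pose thL : {linear A0 -> 'Hom(A0, K^o)} :=
  HB.pack th (GRing.isLinear.Build _ _ _ _ th th_lin).
have ker0 : lker (linfun thL) == 0%VS.
  apply/lker0P => p q; rewrite !lfunE /= => pq.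
  apply/eqP; rewrite -subr_eq0; apply/eqP/(dualizing_nondeg admA dL) => y.
  by rewrite mulrBl linearB /= -!thE pq subrr.
have surj : (linfun thL @: fullv)%VS = fullv.
  apply/eqP; rewrite eqEdim subvf /= limg_dim_eq; last first.
    by rewrite (eqP ker0) capv0.
  by rewrite !dimvf /dim /= muln1.
have : linfun (M : A0 -> K^o) \in (linfun thL @: fullv)%VS.
  by rewrite surj memvf.
case/memv_imgP => q _ Mq; exists q => x.
by rewrite -thE -[th q](lfunE thL) -Mq lfunE.
Qed.

End UnitalExtension.

(** * The exponential of a nilpotent algebra *)

Section Exponential.
Variables (K : numFieldType) (A : nuComAlgType K) (n : nat).
(* The order of truncation n is only bounded below by nilpotency, so that it can
   be raised, and shared by two algebras. *)
Hypothesis An : npow A n.+1 = 0%VS.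
Local Notation A0 := (unital_ext A).
Local Notation inj := (@ue_inj K A).

Definition nexp u : A0 := texp n.+1 (inj u).

Lemma nexpD u v : nexp (u + v) = nexp u * nexp v.
Proof. by rewrite /nexp linearD texpD -?linearD ?nil_ue_inj. Qed.

Lemma nexp0 : nexp 0 = 1.
Proof. by rewrite /nexp linear0 texp0. Qed.

Lemma nexp_inj : injective nexp.
Proof.
move=> u v uv; suff [] : inj u = inj v by [].
by apply: texp_inj uv; rewrite -?linearB nil_ue_inj.
Qed.

Lemma nexp_decomp u : exists x, nexp u = 1 + inj x.
Proof.
exists (nexp u).2; rewrite {1}[nexp u]ue_decomp.
suff -> : (nexp u).1 = 1 by rewrite scale1r.
rewrite /nexp /texp (raddf_sum (@fst K^o A)) big_ord_recl big1 => [|i _] /=.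
  by rewrite addr0 invr1 scale1r.
by rewrite ue_inj_expr scaler0.
Qed.

(** Terms beyond the truncation vanish by nilpotency and the term of index 0
    because the inverse of 0 is 0, so that both index sets can be widened to all
    natural numbers. *)
Lemma nlogE u : nlog (1 + inj u) =
  \sum_(m < n.+1) ((-1) ^+ m.+1 / m%:R) *: (inj u ^+ m).2.
Proof.
rewrite /nlog [1 + _]addrC addrK.
rewrite (fsbig_ord _ n.+1
  (fun m => ((-1) ^+ m.+1 / m%:R : K) *: (inj u ^+ m).2)).
rewrite [LHS](fsbig_widen _ setT) // => [|m /= [_] /negP]; last first.
  by rewrite -eqn0Ngt => /eqP ->; rewrite invr0 mulr0 scale0r.
rewrite [RHS](fsbig_widen _ setT) // => m /= [_] /negP; rewrite -leqNgt => nm.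
by rewrite -(subnK nm) exprD nil_ue_inj // mulr0 scaler0.
Qed.

Lemma nexp_nlog u : nexp (nlog (1 + inj u)) = 1 + inj u.
Proof.
rewrite nlogE -[RHS](texp_log (nil_ue_inj u An)) /nexp; congr texp.
rewrite linear_sum; apply: eq_bigr => -[[|m] lt_m] _ /=.
  by rewrite invr0 mulr0 !scale0r linear0.
rewrite linearZ /=; congr (_ *: _).
by rewrite [RHS]ue_decomp ue_inj_expr scale0r add0r.
Qed.

Lemma nexp_surj x : exists u, nexp u = 1 + inj x.
Proof. by exists (nlog (1 + inj x)); rewrite nexp_nlog. Qed.

Local Open Scope classical_set_scope.

Lemma Spi_nexp (pi : 'End(A)) :
  Spi pi = [set u | ue_proj pi (nexp (u + u)) = 0].
Proof.
apply/seteqP; split => [_ [_ [[x _ <-] xpi] <-]|u upi] /=.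
  by rewrite nexpD nexp_nlog -expr2.
have [x ux] := nexp_decomp u; exists (nexp u).
  by split; [exists x | rewrite expr2 -nexpD].
by rewrite ux; apply: nexp_inj; rewrite nexp_nlog; apply: esym.
Qed.

End Exponential.

(** The functional is a coordinate of the projection on the annihilator. *)
Lemma dualizing_of_projection (K : fieldType) (A : nuComAlgType K)
    (pi : 'End(A)) : admissible A -> admissible_projection pi ->
  exists2 L : {scalar unital_ext A}, dualizing L &
    forall w, ue_proj pi w = 0 <-> L w = 0.
Proof.
move=> [_ dimA] [pi2 piA].
have d0 : (0 < \dim (Ann A))%N by rewrite dimA.
pose i0 := Ordinal d0; pose l (w : unital_ext A) : K :=
  coord (vbasis (Ann A)) i0 (ue_proj pi w).
have l_lin : scalar l.
  by move=> a x y; rewrite /l /ue_proj /= linearP /= linearP.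
pose L : {scalar unital_ext A} :=
  HB.pack l (GRing.isLinear.Build _ _ _ _ l l_lin).
have LE w : ue_proj pi w = 0 <-> L w = 0.
  split=> [w0|Lw]; first by rewrite /L /= /l w0 linear0.
  have : ue_proj pi w \in Ann A by rewrite -piA memv_img ?memvf.
  move/coord_vbasis => ->; apply: big1 => i _.
  have -> : i = i0.
    by apply/val_inj/eqP; move: (ltn_ord i); rewrite {2}dimA ltnS leqn0.
  by rewrite (Lw : coord _ _ _ = 0) scale0r.
exists L => //; split=> [|x xA Lx]; first exact/LE/ue_proj1.
have : ue_proj pi (ue_inj x) = 0 by apply/LE.
rewrite ue_proj_inj; move: xA; rewrite -piA => /memv_imgP[y _ ->].
by rewrite -comp_lfunE pi2.
Qed.

(** * Hypersurfaces that are graphs in two directions *)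

Section GraphHypersurfaces.
Variable K : numClosedFieldType.

Lemma eq_poly_horner (p q : {poly K}) : (forall s, p.[s] = q.[s]) -> p = q.
Proof.
move=> pq; apply/eqP; rewrite -subr_eq0; apply: contraT => /closed_nonrootP[s].
by rewrite rootE hornerD hornerN pq subrr eqxx.
Qed.

Lemma nonroot_poly_const (p : {poly K}) s t :
  (forall x, p.[x] != 0) -> p.[s] = p.[t].
Proof.
move=> p_neq0; have /size_poly1P[c _ ->] : size p == 1.
  by apply: contraT => /closed_rootP[x]; rewrite rootE (negPf (p_neq0 x)).
by rewrite !hornerC.
Qed.

Variables (V : lmodType K) (H G : V -> K) (a b : V).

Definition line_polynomial (F : V -> K) : Prop :=
  forall u v, exists p : {poly K}, forall s, F (u + s *: v) = p.[s].

Hypothesis Ha : forall u t, H (u + t *: a) = H u + t.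
Hypothesis Gb : forall u t, G (u + t *: b) = G u + t.
Hypotheses (Hpoly : line_polynomial H) (Gpoly : line_polynomial G).
Hypothesis zeroHG : forall u, H u = 0 -> G u = 0.

(** With p t = G (u + t a) and q s = H (u + s b), the point
    u + s b - q s a is a zero of H, hence of G, which reads p (- q s) = - s.
    So p and - q compose to - X, and both have degree one. *)
Lemma graph_affine u :
  exists2 c, c != 0 & forall t, G (u + t *: a) = G u + t * c.
Proof.
have [p pE] := Gpoly u a; have [q qE] := Hpoly u b.
have pq : p \Po (- q) = - 'X.
  apply: eq_poly_horner => s; rewrite horner_comp !hornerN hornerX -pE.
  apply/eqP; rewrite -addr_eq0 -Gb addrAC; apply/eqP/zeroHG.
  by rewrite Ha qE subrr.
have size_p : size p = 2.
  have := size_comp_poly p (- q); rewrite pq size_polyN size_polyX /=.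
  move/esym/eqP; rewrite muln_eq1 => /andP[/eqP].
  by case: (size p) => [|[|[|m]]].
have pE2 t : p.[t] = p`_0 + t * p`_1.
  by rewrite horner_coef size_p !big_ord_recl big_ord0 /= mulr1 addr0 mulrC.
exists p`_1.
  have := lead_coef_eq0 p; rewrite lead_coefE size_p /= => ->.
  by rewrite -size_poly_eq0 size_p.
move=> t; have := pE 0; rewrite scale0r addr0 => ->.
by rewrite pE !pE2 mul0r addr0.
Qed.

(** The slope of G in the direction a is polynomial in the base point and never
    zero, hence constant over an algebraically closed field; as G vanishes on
    the graph u - H u a, this slope is the factor of proportionality. *)
Lemma graph_proportional : exists c, forall u, G u = c * H u.
Proof.
have slope_neq0 u : G (u + a) - G u != 0.
  have [c c0 /(_ 1)] := graph_affine u.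
  by rewrite scale1r mul1r => ->; rewrite addrC addKr.
exists (G a - G 0) => u.
have slopeE : G (u + a) - G u = G a - G 0.
  have [p pE] := Gpoly a u; have [q qE] := Gpoly 0 u.
  have rE s : (p - q).[s] = G (s *: u + a) - G (s *: u).
    by rewrite hornerD hornerN -pE -qE add0r (addrC a).
  have := rE 0; rewrite scale0r add0r => <-; have := rE 1.
  rewrite scale1r => <-; apply: nonroot_poly_const => s.
  by rewrite rE.
have [c _ cE] := graph_affine u.
have cG : c = G a - G 0.
  have := cE 1; rewrite -slopeE scale1r mul1r => ->.
  by rewrite addrC addKr.
have : G (u - H u *: a) = 0 by apply: zeroHG; rewrite -scaleNr Ha subrr.
by rewrite -scaleNr cE cG => /eqP; rewrite mulNr subr_eq0 mulrC => /eqP.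
Qed.

End GraphHypersurfaces.

(** * From linear equivalences to algebra morphisms *)

Section TubeEquation.
Variables (K : numFieldType) (A : nuComAlgType K) (n : nat).
Hypothesis An : npow A n.+1 = 0%VS.
Variable L : {scalar unital_ext A}.
Local Notation inj := (@ue_inj K A).
Local Notation exp := (nexp n).

Lemma nexp_ray u : exists2 p : {poly K},
  forall s, L (exp (s *: u)) = p.[s] &
  forall m, (m <= n)%N -> p`_m = (m`!%:R)^-1 * L (inj u ^+ m).
Proof.
exists (\poly_(m < n.+1) ((m`!%:R)^-1 * L (inj u ^+ m))) => [s|m mn].
  rewrite /nexp /texp linear_sum (horner_coef_wide _ (size_poly _ _)).
  apply: eq_bigr => i _.
  rewrite coef_poly ltn_ord [inj (s *: u)]linearZ exprZn !linearZ /=.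
  by rewrite mulrAC mulrA.
by rewrite coef_poly ltnS mn.
Qed.

Lemma nexp_line u v : exists p : {poly K},
  forall s, L (exp (u + s *: v)) = p.[s].
Proof.
exists (\poly_(m < n.+1) ((m`!%:R)^-1 * L (exp u * inj v ^+ m))) => s.
rewrite nexpD // {2}/nexp /texp mulr_sumr linear_sum.
rewrite (horner_coef_wide _ (size_poly _ _)); apply: eq_bigr => m _.
rewrite coef_poly ltn_ord [inj (s *: v)]linearZ exprZn -!scalerAr !linearZ /=.
by rewrite mulrAC mulrA.
Qed.

(** The annihilator kills every higher term of the exponential series. *)
Lemma nexp_Ann u a t : a \in Ann A -> exp (u + t *: a) = exp u + t *: inj a.
Proof.
move=> aN; have ta : nexp n (t *: a) = 1 + t *: inj a.
  have ta2 : inj (t *: a) ^+ 2 = 0.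
    by rewrite expr2 -ue_injM (AnnP _ (memvZ t aN)) linear0.
  by rewrite /nexp (texp_sq0 ta2 (nil_ue_inj _ An)) linearZ.
have [x ux] := nexp_decomp n u.
by rewrite nexpD // ta mulrDr mulr1 -scalerAr ux Ann_mul //= addr0 scale1r.
Qed.

End TubeEquation.

Lemma polarization2 (R : comPzRingType) (x y : R) :
  (x * y) *+ 2 = (x + y) ^+ 2 - x ^+ 2 - y ^+ 2.
Proof. ring. Qed.

Lemma polarization3 (R : comPzRingType) (x y z : R) :
  (x * y * z) *+ 6 = (x + y + z) ^+ 3 - (x + y) ^+ 3 - (y + z) ^+ 3
    - (x + z) ^+ 3 + x ^+ 3 + y ^+ 3 + z ^+ 3.
Proof. ring. Qed.

Section LinearEquivalence.
Variables (K : numClosedFieldType) (A B : nuComAlgType K) (n : nat).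
Hypotheses (An : npow A n.+1 = 0%VS) (Bn : npow B n.+1 = 0%VS).
Hypotheses (admA : admissible A) (admB : admissible B).
Variables (L : {scalar unital_ext A}) (M : {scalar unital_ext B}).
Hypotheses (dL : dualizing L) (dM : dualizing M).
Variable f : 'Hom(A, B).
Hypothesis f_bij : bijective f.

Lemma nexp_proportional :
    (forall u, L (nexp n u) = 0 -> M (nexp n (f u)) = 0) ->
  exists c, forall u, M (nexp n (f u)) = c * L (nexp n u).
Proof.
move=> zeroLM; have [a aN La] := dualizing_Ann admA.2 dL.
have [b bN Mb] := dualizing_Ann admB.2 dM.
have [g fK gK] := f_bij.
apply: (graph_proportional (a := a) (b := g b)) zeroLM => [u t|u t|u v|u v].
- by rewrite nexp_Ann // linearD linearZ /= La mulr1.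
- by rewrite linearD linearZ /= gK nexp_Ann // linearD linearZ /= Mb mulr1.
- exact: nexp_line.
have [p pE] := nexp_line Bn M (f u) (f v).
by exists p => s; rewrite linearD linearZ /= pE.
Qed.

(** Both sides are coefficients of polynomials in s that agree along the ray
    s |-> s u. *)
Lemma nexp_coef c m u : (m <= n)%N ->
    (forall u, M (nexp n (f u)) = c * L (nexp n u)) ->
  M (ue_inj (f u) ^+ m) = c * L (ue_inj u ^+ m).
Proof.
move=> mn McL.
have [p pE pm] := nexp_ray n M (f u); have [q qE qm] := nexp_ray n L u.
have /(congr1 (fun r : {poly K} => r`_m)) : p = c *: q.
  by apply: eq_poly_horner => s; rewrite hornerZ -pE -qE -McL linearZ.
rewrite coefZ pm // qm // mulrCA => /mulfI; apply.
by rewrite invr_eq0 fact_neq0.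
Qed.

(** Truncating at n > 2 keeps the homogeneous parts of degree at most 3, which
    determine the multiplication. *)
Lemma linear_equivalence_morph : (2 < n)%N ->
    (forall u, L (nexp n u) = 0 -> M (nexp n (f u)) = 0) ->
  forall u v, f (nmul u v) = nmul (f u) (f v).
Proof.
move=> n2 /nexp_proportional[c cE] u v.
have E1 x : M (ue_inj (f x)) = c * L (ue_inj x).
  have := nexp_coef x _ cE; move/(_ 1%N); rewrite !expr1; apply.
  exact: ltn_trans n2.
have injD (C : nuComAlgType K) (x y : C) : ue_inj x + ue_inj y = ue_inj (x + y).
  by rewrite linearD.
have fD x y : f x + f y = f (x + y) by rewrite linearD.
have E2 x y : M (ue_inj (f x) * ue_inj (f y)) = c * L (ue_inj x * ue_inj y).
  apply: (@mulIf _ 2); first by rewrite pnatr_eq0.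
  rewrite -[RHS]mulrA !mulr_natr -!raddfMn !polarization2 !(injD, fD).
  rewrite !raddfB /=.
  by rewrite !(nexp_coef _ _ cE) ?(ltnW n2) // !mulrBr.
have E3 x y z : M (ue_inj (f x) * ue_inj (f y) * ue_inj (f z)) =
                c * L (ue_inj x * ue_inj y * ue_inj z).
  apply: (@mulIf _ 6); first by rewrite pnatr_eq0.
  rewrite -[RHS]mulrA !mulr_natr -!raddfMn !polarization3.
  rewrite !(raddfB, raddfD) !(injD, fD) /=.
  by rewrite !(nexp_coef _ _ cE) // !(mulrBr, mulrDr).
apply/eqP; rewrite -subr_eq0; apply/eqP.
apply: (dualizing_nondeg_nil admB.1 dM) => [|w].
  by rewrite !linearB /= E1 !ue_injM E2 subrr.
have [g fK gK] := f_bij; rewrite -[w]gK.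
by rewrite linearB /= mulrBl linearB /= E2 !ue_injM E3 subrr.
Qed.

End LinearEquivalence.

(** * From algebra isomorphisms to affine equivalences *)

Section Functoriality.
Variables (K : numFieldType) (A B : nuComAlgType K) (f : 'Hom(A, B)).
Hypothesis fM : forall u v, f (nmul u v) = nmul (f u) (f v).

Definition ue_map (w : unital_ext A) : unital_ext B := (w.1, f w.2).

Fact ue_map_is_linear : linear ue_map.
Proof. by move=> a x y; rewrite /ue_map /= linearP. Qed.
HB.instance Definition _ := GRing.isLinear.Build K (unital_ext A)
  (unital_ext B) *:%R ue_map ue_map_is_linear.

Lemma ue_map1 : ue_map 1 = 1.
Proof. by rewrite /ue_map linear0. Qed.

Lemma ue_map_inj u : ue_map (ue_inj u) = ue_inj (f u).
Proof. by []. Qed.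

Lemma ue_mapM x y : ue_map (x * y) = ue_map x * ue_map y.
Proof. by rewrite /ue_map /= !linearD /= !linearZ /= fM. Qed.

Lemma ue_map_nexp n u : ue_map (nexp n u) = nexp n (f u).
Proof.
rewrite /nexp /texp linear_sum; apply: eq_bigr => m _; rewrite linearZ /=.
congr (_ *: _); elim: (m : nat) => [|k IHk]; first by rewrite !expr0 ue_map1.
by rewrite !exprS ue_mapM IHk.
Qed.

Lemma Ann_morph a : (forall v, exists u, f u = v) ->
  a \in Ann A -> f a \in Ann B.
Proof.
move=> fs /AnnP aN; apply/AnnP => v; have [u <-] := fs v.
by rewrite -fM aN linear0.
Qed.

End Functoriality.

Lemma half_double (K : numFieldType) (V : lmodType K) (v : V) :
  2^-1 *: v + 2^-1 *: v = v.
Proof.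
rewrite -scalerDl -mulr2n -[_^-1 *+ _]mulr_natl.
by rewrite divff ?scale1r ?pnatr_eq0.
Qed.

Section TubeEquivalence.
Variables (K : numClosedFieldType) (A B : nuComAlgType K) (n : nat).
Hypotheses (An : npow A n.+1 = 0%VS) (Bn : npow B n.+1 = 0%VS).
Hypotheses (admA : admissible A) (admB : admissible B).
Variables (L : {scalar unital_ext A}) (M : {scalar unital_ext B}).
Hypotheses (dL : dualizing L) (dM : dualizing M).

Local Open Scope classical_set_scope.
Local Notation SA := [set u : A | L (nexp n (u + u)) = 0].
Local Notation SB := [set u : B | M (nexp n (u + u)) = 0].

(** The pullback of M is x |-> L (q x) for some q; the scalar part c of q is
    nonzero because f preserves the annihilator, so q = c exp (2 p) and the
    hypersurfaces differ by the translation by p, up to f. *)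
Lemma alg_iso_tube : alg_isomorphic A B -> affinely_equivalent SA SB.
Proof.
move=> [f [f_bij fM]]; have [g fK gK] := f_bij.
have fs v : exists u, f u = v by exists (g v).
have [q qE] := dualizing_represent (M \o ue_map f) admA dL.
have {}qE x : M (ue_map f x) = L (q * x) by rewrite -qE.
have q1 : q.1 != 0.
  have [a aN La] := dualizing_Ann admA.2 dL.
  have := qE (ue_inj a).
  rewrite ue_map_inj Ann_mul // linearZ /= La mulr1 => <-.
  apply/eqP => /(dM.2 _ (Ann_morph fM fs aN)) /eqP.
  rewrite -(linear0 f) (inj_eq (can_inj fK)) => /eqP a0.
  by move: La; rewrite a0 !linear0 => /eqP; rewrite eq_sym oner_eq0.
have [r rE] := nexp_surj An ((q.1 : K)^-1 *: q.2).
have {rE} qr : q = (q.1 : K) *: nexp n r.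
  by rewrite rE scalerDr {1}[q]ue_decomp linearZ /= scalerA divff // scale1r.
move: (q.1 : K) q1 qr => c c0 qc.
pose p := 2^-1 *: r; have pp : p + p = r by apply: half_double.
have MfE u : M (nexp n (f u + f u)) = c * L (nexp n ((u + p) + (u + p))).
  rewrite -linearD -ue_map_nexp // qE qc -scalerAl linearZ /= -nexpD //.
  by rewrite [in RHS]addrACA pp addrC.
exists f, (- f p); split => //; apply/seteqP; split => [_ [x Lx <-]|v Mv] /=.
  by rewrite -linearB MfE subrK Lx mulr0.
exists (g v + p); last by rewrite linearD /= gK addrK.
apply/eqP; have := MfE (g v); rewrite gK (Mv : M _ = 0) => /esym/eqP.
by rewrite mulf_eq0 (negPf c0).
Qed.

(** Moving the origin to another point of the hypersurface of M stays within
    the same class of hypersurfaces, by exp (b + u) = exp b exp u. *)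
Lemma dualizing_translate b : M (nexp n b) = 0 ->
  dualizing (M \o (nexp n b \*o idfun)).
Proof.
move=> Mb; split=> [|x xN] /=; first by rewrite mulr1.
have [y ->] := nexp_decomp n b; rewrite Ann_mul //= addr0 scale1r.
exact: dM.2.
Qed.

(** The linear part f of the affine equivalence is an isomorphism: a translation
    moving the image of 0 to the origin only changes the functional M. *)
Lemma tube_alg_iso : (2 < n)%N ->
  affinely_equivalent SA SB -> alg_isomorphic A B.
Proof.
move=> n2 [f [b [f_bij fSA]]].
have SAB x : L (nexp n (x + x)) = 0 -> M (nexp n ((f x + b) + (f x + b))) = 0.
  by move=> Lx; rewrite -[_ = 0]/(SB (f x + b)) -fSA; exists x.
exists f; split => //.
have Mb : M (nexp n (b + b)) = 0.
  by have := SAB 0; rewrite linear0 !add0r nexp0; apply; case: dL.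
apply: (linear_equivalence_morph An Bn admA admB dL (dualizing_translate Mb))
  => // u Lu.
have := SAB (2^-1 *: u); rewrite half_double => /(_ Lu).
by rewrite addrACA -linearD half_double addrC nexpD.
Qed.

End TubeEquivalence.

(** * The equivalence *)

Theorem proposition2p3 (R : realType) (N N' : nuComAlgType R[i])
    (pi : 'End(N)) (pi' : 'End(N')) :
  admissible N -> admissible N' ->
  admissible_projection pi -> admissible_projection pi' ->
  alg_isomorphic N N' <-> affinely_equivalent (Spi pi) (Spi pi').
Proof.
move=> admN admN' prN prN'.
have [[n Nn] [n' Nn']] := (admN.1, admN'.1).
(* The bound 3 keeps the cubic terms of the exponential. *)
pose m := maxn 3 (maxn n n').
have m2 : (2 < m)%N by rewrite leq_maxl.
have Nm : npow N m.+1 = 0%VS.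
  by apply: npow_eq0_leq Nn; rewrite /m !leq_max leqnn !orbT.
have Nm' : npow N' m.+1 = 0%VS.
  by apply: npow_eq0_leq Nn'; rewrite /m !leq_max leqnn !orbT.
have [L dL LE] := dualizing_of_projection admN prN.
have [L' dL' LE'] := dualizing_of_projection admN' prN'.
have -> : Spi pi = [set u | L (nexp m (u + u)) = 0]%classic.
  by rewrite (Spi_nexp Nm); apply/seteqP; split => u /LE.
have -> : Spi pi' = [set u | L' (nexp m (u + u)) = 0]%classic.
  by rewrite (Spi_nexp Nm'); apply/seteqP; split => u /LE'.
split; first exact: alg_iso_tube.
exact: tube_alg_iso.
Qed.
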